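(* Let $\mathcal{X}$ be a finite-dimensional Euclidean space and let $\mathcal{H}\subset\mathbb{S}$ be a linear subspace of self-adjoint operators on $\mathcal{X}$ satisfying properties (i)–(iii) of the context. Let $\mathcal{R}>0$ and $\eta=\mathcal{R}$. Let $\mathbf{S}_k\in\mathcal{H}\cap\mathbb{S}_{++}$ with $\mathbf{S}_{k+1}\succeq\mathbf{S}_k$ for all $k\in\mathbb{N}_0$. Let $K\in\mathbb{N}_0$, $g_0,\dots,g_K\in\mathcal{X}$ and $x_0=0$. Let $x_1,\dots,x_{K+1}$ be generated by $$x_{k+1}=-\nabla\Psi_k^*(m_k),\qquad m_k=\sum_{i=0}^k g_i,\qquad \Psi_k^*(m)=\eta\,\big\|\sqrt{\mathrm{proj}_{\mathcal{H}}(\mathbf{out}(m))+\mathbf{S}_k}\big\|_{\mathrm{tr}},\qquad k=0,\dots,K.$$ Then $$\mathrm{Reg}_K^+\le \Psi_0^*(0)+\tfrac32\,\eta\,\big\|\sqrt{\mathbf{S}_K}\big\|_{\mathrm{tr}}-\sum_{k=0}^K\frac{1}{4\eta}\|x_{k+1}-x_k\|^2_{\mathbf{S}_k^{1/2}},$$ where $\mathrm{Reg}_K^+=\max_{x\in Q_{\mathcal{R}}}\sum_{k=0}^K\langle g_k,x_{k+1}-x\rangle$.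
   Context: $\mathcal{X}$ is a finite-dimensional real Euclidean space with inner product $\langle\cdot,\cdot\rangle$ and norm $\|\cdot\|$. $\mathbb{S}$ is the space of self-adjoint linear operators $\mathcal{X}\to\mathcal{X}$ with inner product $\langle\mathbf{A},\mathbf{B}\rangle=\mathrm{tr}(\mathbf{A}\mathbf{B}^* )$; $\mathbb{S}_{++}\subset\mathbb{S}$ is the set of positive definite operators; $\succeq$ is the Löwner order; $\mathbf{I}$ is the identity operator. $\|\mathbf{A}\|_{\mathrm{tr}}=\mathrm{tr}\sqrt{\mathbf{A}\mathbf{A}^*}$ and $\|\mathbf{A}\|_{\mathrm{op}}=\max_{\|x\|\le1}\|\mathbf{A}x\|$ are the trace and operator norms. For $\mathbf{H}\in\mathbb{S}_{++}$, $\|x\|_{\mathbf{H}}^2=\langle x,\mathbf{H}x\rangle$. For $z\in\mathcal{X}$, $\mathbf{out}(z)\in\mathbb{S}$ is the rank-one operator $x\mapsto z\langle z,x\rangle$. $\mathrm{proj}_{\mathcal{H}}$ is the orthogonal projection of $\mathbb{S}$ onto $\mathcal{H}$. $\mathbb{N}_0$ is the set of non-negative integers. The linear subspace $\mathcal{H}\subset\mathbb{S}$ satisfies: (i) $\mathbf{I}\in\mathcal{H}$; (ii) $\mathbf{H}\mathbf{F}\mathbf{H}\in\mathcal{H}$ for all $\mathbf{H},\mathbf{F}\in\mathcal{H}$; (iii) $\mathrm{proj}_{\mathcal{H}}(\mathbf{H})\in\mathbb{S}_{++}$ for all $\mathbf{H}\in\mathbb{S}_{++}$. The norm $\rho$ on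 $\mathcal{X}$ is $\rho(x)=\big\|\sqrt{\mathrm{proj}_{\mathcal{H}}(\mathbf{out}(x))}\big\|_{\mathrm{op}}$, and $Q_{\mathcal{R}}=\{x\in\mathcal{X}:\rho(x)\le\mathcal{R}\}$. The functions $\Psi_k^*$ are differentiable on $\mathcal{X}$. *)

(* Defs.v *)
From HB Require Import structures.
From mathcomp Require Import all_boot all_order all_algebra.
From mathcomp Require Import sesquilinear.
From mathcomp Require Import boolp classical_sets reals.

Set Implicit Arguments.
Unset Strict Implicit.
Unset Printing Implicit Defensive.

Import Order.TTheory GRing.Theory Num.Theory.
Local Open Scope classical_set_scope.
Local Open Scope ring_scope.

(* A finite-dimensional real Euclidean space is a [vectType] over the reals
   together with a symmetric positive definite form [ip : {dot X for idfun}].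
   Linear operators are the elements of 'End(X). *)

Definition is_maximum (R : realType) (E : set R) (M : R) : Prop :=
  E M /\ ubound E M.

Section Euclidean.
Variables (R : realType) (X : vectType R) (ip : {dot X for idfun}).
Implicit Types (A B P : 'End(X)) (H : {vspace 'End(X)}) (x y z m : X).

Definition enorm x : R := Num.sqrt (ip x x).

(* [xget 0 E] is an element of E, and 0 if E is empty. Every set E it is
   applied to below has at most one element, and exactly one when the named
   object exists. *)

Definition adjoint A : 'End(X) :=
  xget 0 [set B : 'End(X) | forall x y, ip (A x) y = ip x (B y)].

(* The matrix trace in an arbitrary basis. *)
Definition optr A : R := \tr (passmx.mxof (vbasis {:X}) (vbasis {:X}) A).

Definition ipop A B : R := optr (A \o adjoint B)%VF.

Definition selfadjoint A : Prop := forall x y, ip (A x) y = ip x (A y).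

Definition psd A : Prop := selfadjoint A /\ forall x, 0 <= ip x (A x).

Definition pd A : Prop := selfadjoint A /\ forall x, x != 0 -> 0 < ip x (A x).

Definition loewner_le A B : Prop := psd (B - A).

Definition opsqrt A : 'End(X) := xget 0 [set B : 'End(X) | psd B /\ (B \o B)%VF = A].

Definition trnorm A : R := optr (opsqrt (A \o adjoint A)%VF).

Definition opnorm A : R := sup [set enorm (A x) | x in [set x | enorm x <= 1]].

(* The square of the norm weighted by A. *)
Definition wnorm2 A x : R := ip x (A x).

Definition out z : 'End(X) := linfun (fun x => ip z x *: z).

Definition oproj H A : 'End(X) :=
  xget 0 [set P : 'End(X) | P \in H /\ forall B, B \in H -> ipop (A - P) B = 0].

Definition is_gradient (f : X -> R) x z : Prop :=
  forall e : R, 0 < e -> exists2 d : R, 0 < d &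
    forall y, enorm y < d -> `|f (x + y) - f x - ip z y| <= e * enorm y.

Definition grad (f : X -> R) x : X := xget 0 [set z : X | is_gradient f x z].

Definition rho H x : R := opnorm (opsqrt (oproj H (out x))).

Definition rho_ball H (r : R) : set X := [set x | rho H x <= r].

Definition Psi_star H (eta : R) A m : R :=
  eta * trnorm (opsqrt (oproj H (out m) + A)).

End Euclidean.

(* Main.v *)
(* The gradient of [m |-> tr sqrt (proj (out m) + S)] is [J m], where [J] is the
   inverse of [B m = sqrt (proj (out m) + S)]; everything rests on square
   completions under the trace rather than on differentiation.  [H] is closed
   under polynomials in each of its elements, so it contains square roots and
   inverses, and the projection disappears under the trace against them.
   - [tr J (B' - B)^2 >= 0] gives the quadratic upper bound on [tr B'], and
     completing the square in the form of [B'] gives convexity.  Together they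
     yield the gradient and a Bregman lower bound in the norm of [sqrt S].
   - Telescoping leaves the drift [tr B_(k+1) - tr B_k] at a fixed [m], which is
     at most [tr sqrt S_(k+1) - tr sqrt S_k] and also dominates the squared
     change of gradient; the latter accounts for the factor 3/2.
   - The dual norm of [rho] is [tr sqrt (proj (out m))], attained at a
     pseudo-inverse image of [m], so no compactness argument is needed. *)

Require Import Defs.
From HB Require Import structures.
From mathcomp Require Import all_boot all_order all_algebra.
From mathcomp Require Import sesquilinear ring lra.
From mathcomp Require Import boolp classical_sets reals.
From mathcomp Require Import complex.

Set Implicit Arguments.
Unset Strict Implicit.
Unset Printing Implicit Defensive.

Import Order.TTheory GRing.Theory Num.Theory.
Local Open Scope classical_set_scope.
Local Open Scope ring_scope.

(** * Trace and positive operators *)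

Section EuclideanOperators.
Local Open Scope lfun_scope.
Context {R : realType} {X : vectType R} {ip : {dot X for idfun}}.
Implicit Types (A B C D P : 'End(X)) (x y z u v w : X) (a b c : R).

Lemma ipC x y : ip x y = ip y x.
Proof. by have := hermC ip x y; rewrite expr0 mul1r. Qed.

Lemma ipDl x y z : ip (x + y) z = ip x z + ip y z.
Proof. exact: linearDl. Qed.

Lemma ipZl a x y : ip (a *: x) y = a * ip x y.
Proof. exact: linearZl_LR. Qed.

Lemma ipDr x y z : ip z (x + y) = ip z x + ip z y.
Proof. by rewrite !(ipC z) ipDl. Qed.

Lemma ipZr a x y : ip x (a *: y) = a * ip x y.
Proof. by rewrite !(ipC x) ipZl. Qed.

Lemma ipNl x y : ip (- x) y = - ip x y.
Proof. by rewrite -scaleN1r ipZl mulN1r. Qed.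

Lemma ipNr x y : ip x (- y) = - ip x y.
Proof. by rewrite !(ipC x) ipNl. Qed.

Definition ipE := (ipDl, ipDr, ipNl, ipNr, ipZl, ipZr).

Lemma ip0l x : ip 0 x = 0.
Proof. by rewrite -(scale0r x) ipZl mul0r. Qed.

Lemma ip0r x : ip x 0 = 0.
Proof. by rewrite ipC ip0l. Qed.

Lemma ip_suml (I : Type) (r : seq I) (F : I -> X) x :
  ip (\sum_(i <- r) F i) x = \sum_(i <- r) ip (F i) x.
Proof. exact: linear_sumlz. Qed.

Lemma ip_sumr (I : Type) (r : seq I) (F : I -> X) x :
  ip x (\sum_(i <- r) F i) = \sum_(i <- r) ip x (F i).
Proof. by rewrite ipC ip_suml; apply: eq_bigr => i _; rewrite ipC. Qed.

Lemma ip_gt0 x : x != 0 -> 0 < ip x x.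
Proof. exact: neq0_dnorm_gt0. Qed.

Lemma ip_ge0 x : 0 <= ip x x.
Proof.
by have [->|/ip_gt0/ltW//] := eqVneq x 0; rewrite ip0l.
Qed.

Lemma ip_eq0 x : ip x x = 0 -> x = 0.
Proof. by have [//|/ip_gt0] := eqVneq x 0; move=> /[swap] ->; rewrite ltxx. Qed.

Lemma ip_inj x y : (forall z, ip z x = ip z y) -> x = y.
Proof.
move=> xy; apply/subr0_eq/ip_eq0.
by rewrite ipDr ipNr xy subrr.
Qed.

Lemma enorm_ge0 x : 0 <= enorm ip x. Proof. exact: sqrtr_ge0. Qed.

Lemma enorm_sqr x : enorm ip x ^+ 2 = ip x x.
Proof. by rewrite sqr_sqrtr ?ip_ge0. Qed.

Lemma enorm0 : enorm ip 0 = 0.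
Proof. by rewrite /enorm ip0l sqrtr0. Qed.

Lemma enormZ a x : 0 <= a -> enorm ip (a *: x) = a * enorm ip x.
Proof.
move=> a0; rewrite /enorm ipZl ipZr mulrA sqrtrM ?mulr_ge0//.
by rewrite -expr2 sqrtr_sqr ger0_norm.
Qed.

Definition rank1 z x : X := ip z x *: z.

Fact rank1_linear z : linear (rank1 z).
Proof. by move=> a x y; rewrite /rank1 ipDr ipZr scalerDl scalerA. Qed.
HB.instance Definition _ z := GRing.isLinear.Build R X X _
  (rank1 z) (rank1_linear z).

Lemma outE z x : out ip z x = ip z x *: z.
Proof. exact: (lfunE (rank1 z)). Qed.

Lemma outZ a z : out ip (a *: z) = a ^+ 2 *: out ip z.
Proof. by apply/lfunP => x; rewrite scale_lfunE !outE ipZl !scalerA;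
  congr (_ *: _); ring. Qed.

Lemma outN z : out ip (- z) = out ip z.
Proof. by rewrite -scaleN1r outZ sqrrN expr1n scale1r. Qed.

Fact optr_is_scalar : scalar (@optr R X).
Proof. by move=> a A B; rewrite /optr passmx.mxof_linear mxtraceD mxtraceZ. Qed.
HB.instance Definition _ := GRing.isLinear.Build R 'End(X) R *%R
  (@optr R X) optr_is_scalar.

Lemma optrD A B : optr (A + B) = optr A + optr B. Proof. exact: raddfD. Qed.
Lemma optrN A : optr (- A) = - optr A. Proof. exact: raddfN. Qed.
Lemma optrB A B : optr (A - B) = optr A - optr B. Proof. exact: raddfB. Qed.
Lemma optr0 : optr (0 : 'End(X)) = 0. Proof. exact: raddf0. Qed.
Lemma optrZ a A : optr (a *: A) = a * optr A. Proof. exact: linearZ. Qed.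

Lemma optr_sum (I : Type) (r : seq I) (F : I -> 'End(X)) :
  optr (\sum_(i <- r) F i) = \sum_(i <- r) optr (F i).
Proof. exact: raddf_sum. Qed.

Lemma optrC A B : optr (A \o B) = optr (B \o A).
Proof. by rewrite /optr !(passmx.mxof_comp _ _ (vbasisP _)) mxtrace_mulC. Qed.

(** The diagonal entry at the basis vector [e_i] is [<z, e_i>] times the [i]-th coordinate of [A z];
    the basis need not be orthonormal. *)
Lemma optr_out A z : optr (A \o out ip z) = ip z (A z).
Proof.
rewrite /optr /mxtrace [in RHS](coord_vbasis (memvf (A z))) ip_sumr.
apply: eq_bigr => i _; rewrite !mxE /= passmx.vecof_delta comp_lfunE outE.
by rewrite !linearZ /= mulrC.
Qed.

End EuclideanOperators.

(** * The Löwner order, rank-one decompositions and inverses *)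

Section PositiveOperators.
Local Open Scope lfun_scope.
Context {R : realType} {X : vectType R} {ip : {dot X for idfun}}.
Implicit Types (A B C D P : 'End(X)) (x y z u v w : X) (a b c : R).

Lemma selfadjointD A B :
  selfadjoint ip A -> selfadjoint ip B -> selfadjoint ip (A + B).
Proof. by move=> sA sB x y; rewrite !add_lfunE !ipE sA sB. Qed.

Lemma selfadjointZ a A : selfadjoint ip A -> selfadjoint ip (a *: A).
Proof. by move=> sA x y; rewrite !scale_lfunE !ipE sA. Qed.

Lemma selfadjointN A : selfadjoint ip A -> selfadjoint ip (- A).
Proof. by move=> sA x y; rewrite !opp_lfunE !ipE sA. Qed.

Lemma selfadjointB A B :
  selfadjoint ip A -> selfadjoint ip B -> selfadjoint ip (A - B).
Proof. by move=> sA sB; apply: selfadjointD => //; apply: selfadjointN. Qed.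

Lemma selfadjoint0 : selfadjoint ip 0.
Proof. by move=> x y; rewrite !zero_lfunE ip0l ip0r. Qed.

Lemma selfadjoint1 : selfadjoint ip \1.
Proof. by move=> x y; rewrite !id_lfunE. Qed.

Lemma selfadjoint_out z : selfadjoint ip (out ip z).
Proof. by move=> x y; rewrite !outE !ipE (ipC x z) mulrC. Qed.

Lemma selfadjoint_conj A B :
  selfadjoint ip A -> selfadjoint ip B -> selfadjoint ip (A \o B \o A).
Proof. by move=> sA sB x y; rewrite !comp_lfunE sA sB sA. Qed.

Lemma psd_conj A B :
  selfadjoint ip A -> psd ip B -> psd ip (A \o B \o A).
Proof.
move=> sA [sB B0]; split; first exact: selfadjoint_conj.
by move=> x; rewrite !comp_lfunE -sA.
Qed.

Lemma psd_sqr A : selfadjoint ip A -> psd ip (A \o A).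
Proof.
move=> sA; split=> [x y|x]; rewrite !comp_lfunE; first by rewrite !sA.
by rewrite -sA ip_ge0.
Qed.

Lemma psdD A B : psd ip A -> psd ip B -> psd ip (A + B).
Proof.
move=> [sA A0] [sB B0]; split; first exact: selfadjointD.
by move=> x; rewrite add_lfunE ipDr addr_ge0.
Qed.

Lemma psdZ a A : 0 <= a -> psd ip A -> psd ip (a *: A).
Proof.
move=> a0 [sA A0]; split; first exact: selfadjointZ.
by move=> x; rewrite scale_lfunE ipZr mulr_ge0.
Qed.

Lemma psd0 : psd ip 0.
Proof. by split=> [|x]; [exact: selfadjoint0|rewrite zero_lfunE ip0r]. Qed.

Lemma psd1 : psd ip \1.
Proof. by split=> [|x]; [exact: selfadjoint1|rewrite id_lfunE ip_ge0]. Qed.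

Lemma psd_out z : psd ip (out ip z).
Proof.
split; first exact: selfadjoint_out.
by move=> x; rewrite outE ipZr (ipC x) -expr2 sqr_ge0.
Qed.

Lemma pd_psd A : pd ip A -> psd ip A.
Proof.
move=> [sA A0]; split=> // x.
by have [->|/A0/ltW//] := eqVneq x 0; rewrite ip0l.
Qed.

Lemma pd_psdD A B : pd ip A -> psd ip B -> pd ip (A + B).
Proof.
move=> [sA A0] [sB B0]; split=> [|x x0]; first exact: selfadjointD.
by rewrite add_lfunE ipDr ltr_pwDl// A0.
Qed.

Lemma pd_psdDr A B : psd ip A -> pd ip B -> pd ip (A + B).
Proof. by move=> pA pB; rewrite addrC; apply: pd_psdD. Qed.

Lemma pdZ1 a : 0 < a -> pd ip (a *: \1).
Proof.
move=> a0; split=> [|x x0]; first exact/selfadjointZ/selfadjoint1.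
by rewrite scale_lfunE id_lfunE ipZr mulr_gt0// ip_gt0.
Qed.

Lemma loewner_leP A B x : loewner_le ip A B -> ip x (A x) <= ip x (B x).
Proof.
by move=> [_ /(_ x)]; rewrite add_lfunE opp_lfunE ipDr ipNr subr_ge0.
Qed.

Lemma loewner_leD A B C : loewner_le ip A B -> loewner_le ip (C + A) (C + B).
Proof. by rewrite /loewner_le opprD addrACA subrr add0r. Qed.

Lemma psd_CauchySchwarz A x y : psd ip A ->
  ip x (A y) ^+ 2 <= ip x (A x) * ip y (A y).
Proof.
move=> [sA A0].
have q t : 0 <= ip x (A x) + 2 * t * ip x (A y) + t ^+ 2 * ip y (A y).
  have := A0 (x + t *: y); rewrite linearD linearZ /= !ipE.
  by rewrite (ipC y (A x)) sA; congr (0 <= _); ring.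
have [yy|yy] := eqVneq (ip y (A y)) 0.
  rewrite yy mulr0.
  have [->|xy] := eqVneq (ip x (A y)) 0; first by rewrite expr0n.
  (* In this case [q] is affine in [t], and this [t] gives it the value -1. *)
  have := q (- (ip x (A x) + 1) / (2 * ip x (A y))).
  rewrite yy mulr0 addr0.
  have -> : 2 * (- (ip x (A x) + 1) / (2 * ip x (A y))) * ip x (A y) =
            - (ip x (A x) + 1) by field.
  by rewrite opprD addrA subrr sub0r oppr_ge0 ler10.
have y0 : 0 < ip y (A y) by rewrite lt_def yy A0.
(* This [t] minimizes the quadratic polynomial. *)
have := q (- ip x (A y) / ip y (A y)).
have -> : ip x (A x) + 2 * (- ip x (A y) / ip y (A y)) * ip x (A y) +
   (- ip x (A y) / ip y (A y)) ^+ 2 * ip y (A y) =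
   (ip x (A x) * ip y (A y) - ip x (A y) ^+ 2) / ip y (A y) by field.
by rewrite pmulr_lge0 ?invr_gt0// subr_ge0.
Qed.

Lemma CauchySchwarz x y : ip x y ^+ 2 <= ip x x * ip y y.
Proof. by have := psd_CauchySchwarz x y psd1; rewrite !id_lfunE. Qed.

Lemma psd_ker A x : psd ip A -> ip x (A x) = 0 -> A x = 0.
Proof.
move=> pA xx; apply: (ip_inj (ip := ip)) => y; rewrite ip0r.
have := psd_CauchySchwarz y x pA; rewrite xx mulr0 => h.
by apply/eqP; rewrite -sqrf_eq0 eq_le h sqr_ge0.
Qed.

Lemma psd_antisym A : psd ip A -> psd ip (- A) -> A = 0.
Proof.
move=> pA [_ nA]; apply/lfunP => x; rewrite zero_lfunE.
apply: (psd_ker pA); apply/eqP; rewrite eq_le; have := nA x.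
by rewrite opp_lfunE ipNr oppr_ge0 => ->; case: pA => _ ->.
Qed.

(* The Schur complement step of the Cholesky factorization. *)
Lemma psd_sum_out A : psd ip A ->
  exists s : seq X, A = \sum_(z <- s) out ip z.
Proof.
(* Induction on the rank, measured as the codimension of the kernel. *)
have [n] := ubnP (\dim {:X} - \dim (lker A)).
elim: n A => // n IHn A; rewrite ltnS => dimA pA.
have [[v Av]|A0] := pselect (exists v, A v != 0); last first.
  exists [::]; rewrite big_nil; apply/lfunP => x; rewrite zero_lfunE.
  by apply/eqP/negPn/negP => Ax; apply: A0; exists x.
have [sA geA] := pA.
have c0 : 0 < ip v (A v).
  rewrite lt_def geA andbT; apply: contraNneq Av => /(psd_ker pA) ->//.
pose w := (Num.sqrt (ip v (A v)))^-1%R *: A v.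
have outw x : out ip w x = (ip v (A x) / ip v (A v)) *: A v.
  rewrite outE /w ipZl scalerA mulrAC -expr2 exprVn sqr_sqrtr ?ltW//.
  by rewrite sA mulrC.
pose A' := A - out ip w.
have pA' : psd ip A'.
  split; first exact/selfadjointB/selfadjoint_out.
  move=> x; rewrite /A' add_lfunE opp_lfunE outw ipDr ipNr ipZr subr_ge0.
  rewrite mulrAC ler_pdivrMr// (ipC v) sA -expr2.
  exact: psd_CauchySchwarz.
have kerA : (lker A <= lker A')%VS.
  apply/subvP => x; rewrite !memv_ker /A' add_lfunE opp_lfunE outw => /eqP ->.
  by rewrite ip0r mul0r scale0r subrr.
have vker : v \in lker A'.
  by rewrite memv_ker /A' add_lfunE opp_lfunE outw divff ?gt_eqF// scale1r
    subrr.
have dimlt : (\dim (lker A) < \dim (lker A'))%N.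
  rewrite ltn_neqAle dimvS// andbT; apply: contraNneq Av => dE.
  have /eqP kE : lker A == lker A' by rewrite eqEdim kerA dE leqnn.
  by rewrite -memv_ker kE.
have [||s sE] := IHn A' => //.
  apply: leq_trans dimA; apply: ltn_sub2l => //.
  exact: leq_trans dimlt (dimvS (subvf _)).
by exists (w :: s); rewrite big_cons -sE /A' addrC subrK.
Qed.

(** Splitting [B] into rank-one terms turns the trace into a sum of values [<z, A z>]. *)
Lemma optr_psd_mul A B : psd ip A -> psd ip B -> 0 <= optr (A \o B).
Proof.
move=> [sA A0] /psd_sum_out[s ->].
have -> : (A \o \sum_(z <- s) out ip z) = \sum_(z <- s) (A \o out ip z).
  by elim/big_rec2: _ => [|z B' C _ <-]; rewrite ?comp_lfun0r ?comp_lfunDr.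
by rewrite optr_sum; apply: sumr_ge0 => z _; rewrite optr_out.
Qed.

Lemma optr_ge0 A : psd ip A -> 0 <= optr A.
Proof. by move=> pA; rewrite -[A]comp_lfun1r optr_psd_mul//; exact: psd1. Qed.

Lemma optr_out1 z : optr (out ip z) = ip z z.
Proof. by rewrite -[out ip z]comp_lfun1l optr_out id_lfunE. Qed.

Lemma optr_eq0 A : psd ip A -> optr A = 0 -> A = 0.
Proof.
move=> /psd_sum_out[s ->]; rewrite optr_sum => /eqP.
rewrite psumr_eq0 => [/allP sz|z _]; last by rewrite optr_out1 ip_ge0.
rewrite big_seq big1// => z /sz; rewrite optr_out1 => /= /eqP /ip_eq0 ->.
by apply/lfunP => x; rewrite outE scaler0 zero_lfunE.
Qed.

Lemma psd_le_optr A x : psd ip A -> ip x (A x) <= optr A * ip x x.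
Proof.
move=> /psd_sum_out[s ->]; rewrite optr_sum mulr_suml sum_lfunE ip_sumr.
apply: ler_sum => z _; rewrite outE optr_out1 ipZr (ipC x z) -expr2.
exact: CauchySchwarz.
Qed.

(** Definiteness of the trace form; existence and uniqueness of projections rest on it. *)
Lemma selfadjoint_sqr_eq0 A : selfadjoint ip A -> optr (A \o A) = 0 -> A = 0.
Proof.
move=> sA /(optr_eq0 (psd_sqr sA)) AA0.
apply/lfunP => x; rewrite zero_lfunE; apply: (ip_eq0 (ip := ip)).
by rewrite sA -comp_lfunE AA0 zero_lfunE ip0r.
Qed.

Lemma optr_psd_mul_le A B C : psd ip C -> loewner_le ip A B ->
  optr (C \o A) <= optr (C \o B).
Proof.
move=> pC AB; rewrite -subr_ge0 -optrB -comp_lfunNr -comp_lfunDr.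
exact: optr_psd_mul.
Qed.

Lemma pd_lker0 A : pd ip A -> lker A == 0%VS.
Proof.
move=> [sA A0]; apply/lker0P => x y Axy; apply: subr0_eq.
apply: contrapT => /eqP /A0.
by rewrite linearB /= Axy subrr ip0r ltxx.
Qed.

Lemma pd_invr A : pd ip A -> A \o A^-1 = \1.
Proof. by move=> /pd_lker0; exact: lker0_compfV. Qed.

Lemma pd_invl A : pd ip A -> A^-1 \o A = \1.
Proof. by move=> /pd_lker0; exact: lker0_compVf. Qed.

Lemma pd_inv A : pd ip A -> pd ip (A^-1).
Proof.
move=> pA; have AV x : A (A^-1 x) = x.
  by rewrite -comp_lfunE pd_invr// id_lfunE.
have sAV : selfadjoint ip (A^-1).
  move=> x y; rewrite -{2}(AV x) -{1}(AV y).
  by case: pA => sA _; rewrite sA.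
split=> // x x0; rewrite -{1}(AV x) ipC; case: pA => sA; apply.
by apply: contraNneq x0 => Ax0; rewrite -(AV x) Ax0 linear0.
Qed.

(** With [y = B^-1 x], the form of [A] at [A^-1 x - y] is non-negative, and
    [<y, A y> <= <y, B y> = <x, y>]. *)
Lemma pd_inv_le A B : pd ip A -> pd ip B -> loewner_le ip A B ->
  loewner_le ip (B^-1) (A^-1).
Proof.
move=> pA pB AB; have [sAV _] := pd_inv pA; have [sBV _] := pd_inv pB.
split; first exact: selfadjointB.
move=> x; rewrite add_lfunE opp_lfunE ipDr ipNr subr_ge0.
set y := B^-1 x.
have By : B y = x by rewrite /y -comp_lfunE pd_invr// id_lfunE.
have AVx : A (A^-1 x) = x by rewrite -comp_lfunE pd_invr// id_lfunE.
have [sA A0] := pd_psd pA.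
have := A0 ((A^-1)%VF x - y); rewrite linearB /= AVx !ipE.
rewrite -sA AVx -!(ipC x).
by have := loewner_leP y AB; rewrite By (ipC y x); lra.
Qed.

End PositiveOperators.

(** * Polynomials in a self-adjoint operator *)

Section FunctionalCalculus.
Local Open Scope lfun_scope.
Context {R : realType} {X : vectType R} {ip : {dot X for idfun}}.
Implicit Types (A B C : 'End(X)) (x y z v w : X) (a b c : R).
Implicit Types (p q : {poly R}).

Definition lpow A i : 'End(X) := iter i (comp_lfun A) \1.

Definition pev A p : 'End(X) := \sum_(i < size p) p`_i *: lpow A i.

Lemma pev_wide n A p : (size p <= n)%N ->
  pev A p = \sum_(i < n) p`_i *: lpow A i.
Proof.
move=> pn; rewrite /pev (big_ord_widen _ (fun i => p`_i *: lpow A i) pn).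
rewrite big_mkcond; apply: eq_bigr => i _.
by case: ltnP => // /(nth_default _) ->; rewrite scale0r.
Qed.

Lemma pev_is_linear A : linear (pev A).
Proof.
move=> a p q; pose n := maxn (size (a *: p + q)) (maxn (size p) (size q)).
rewrite !(@pev_wide n) ?leq_max ?leqnn ?orbT//.
rewrite scaler_sumr -big_split; apply: eq_bigr => i _ /=.
by rewrite coefD coefZ scalerDl scalerA.
Qed.
HB.instance Definition _ A := GRing.isLinear.Build R {poly R} 'End(X) _
  (pev A) (pev_is_linear A).

Lemma pevC A c : pev A c%:P = c *: \1.
Proof. by rewrite (@pev_wide 1) ?size_polyC_leq1// big_ord1 coefC. Qed.

Lemma pevMX A p : pev A (p * 'X) = A \o pev A p.
Proof.
rewrite (@pev_wide (size p).+1); last first.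
  by have [->|p0] := eqVneq p 0; rewrite ?mul0r ?size_poly0// size_mulX.
rewrite big_ord_recl coefMX scale0r add0r /pev.
rewrite (big_morph (comp_lfun A) (@comp_lfunDr _ _ _ _ A) (@comp_lfun0r _ _ _
  _ A)).
by apply: eq_bigr => i _; rewrite coefMX /= comp_lfunZr.
Qed.

Lemma pevX A : pev A 'X = A.
Proof. by rewrite -['X]mul1r pevMX pevC scale1r comp_lfun1r. Qed.

Lemma pevM A p q : pev A (p * q) = pev A p \o pev A q.
Proof.
elim/poly_ind: p => [|p c IHp]; first by rewrite mul0r linear0 comp_lfun0l.
rewrite mulrDl mulrAC mul_polyC !linearD /= linearZ /= !pevMX IHp pevC.
by rewrite comp_lfunDl comp_lfunA -comp_lfunZl comp_lfun1l.
Qed.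

Lemma pev_comm A p : A \o pev A p = pev A p \o A.
Proof. by rewrite -pevMX pevM pevX. Qed.

Lemma pev_eigen A v a p : A v = a *: v -> pev A p v = p.[a] *: v.
Proof.
move=> Av; elim/poly_ind: p => [|p c IHp].
  by rewrite linear0 horner0 zero_lfunE scale0r.
rewrite linearD /= pevMX pevC add_lfunE scale_lfunE comp_lfunE IHp id_lfunE.
by rewrite linearZ /= Av !hornerE scalerDl scalerA.
Qed.

Lemma selfadjoint_pev A p : selfadjoint ip A -> selfadjoint ip (pev A p).
Proof.
move=> sA; elim/poly_ind: p => [|p c IHp]; first by rewrite linear0;
  exact: selfadjoint0.
rewrite linearD /= pevMX pevC; apply: selfadjointD;
  last exact/selfadjointZ/selfadjoint1.
by move=> x y; rewrite {2}pev_comm !comp_lfunE sA IHp.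
Qed.

Definition eigen A a := exists2 v, v != 0 & A v = a *: v.

(** The powers of [A] up to the dimension of the operator space are one too many to be
    independent. *)
Lemma annihilating_poly A : exists2 p, p != 0 & pev A p = 0.
Proof.
pose d := \dim {:'End(X)}; pose T := [tuple lpow A i | i < d.+1].
have : ~~ free T.
  rewrite /free size_tuple neq_ltn ltnS.
  by rewrite dimvS// subvf.
move=> nT; have /existsNP[k] : ~ forall k : 'I_d.+1 -> R,
    \sum_(i < d.+1) k i *: T`_i = 0 -> (forall i, k i = 0).
  by move=> /freeP fT; rewrite fT in nT.
move=> /not_implyP[kT /existsNP[i0 ki0]].
pose p := \poly_(i < d.+1) k (inord i).
have pk (i : 'I_d.+1) : p`_i = k i by rewrite coef_poly ltn_ord inord_val.
exists p.
  by apply/eqP => p0; apply: ki0; rewrite -pk p0 coef0.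
rewrite (pev_wide _ (size_poly _ _)) -[RHS]kT; apply: eq_bigr => i _.
by rewrite pk -tnth_nth tnth_mktuple.
Qed.

(** The product of [X - l] and [X - conj l], written with real coefficients. *)
Definition quad (l : R[i]) : {poly R} :=
  ('X - (complex.Re l)%:P) ^+ 2 + ((complex.Im l) ^+ 2)%:P.

(* The square of a real polynomial is, up to a constant, the product of the
   real quadratics attached to its complex roots. *)
Lemma annihilating_quad A : exists s, pev A (\prod_(l <- s) quad l) = 0.
Proof.
have [p p0 Ap] := annihilating_poly A.
pose f := real_complex R; pose P := map_poly f p.
have [s Ps] := closed_field_poly_normal P.
exists s.
have lP : lead_coef P = f (lead_coef p) by rewrite lead_coef_map.
have conjP : map_poly (@conjc R) P = P.
  rewrite /P -map_poly_comp; apply: eq_map_poly => x /=.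
  exact: conjc_real.
have conjX l : map_poly (@conjc R) ('X - l%:P) = 'X - (conjc l)%:P.
  by rewrite rmorphB /= map_polyX map_polyC.
have quadE l : map_poly f (quad l) = ('X - l%:P) * ('X - (conjc l)%:P).
  rewrite rmorphD rmorphXn rmorphB /= map_polyX !map_polyC /=.
  case: l => a b /=.
  rewrite (complexE (a +i* b)%C) (complexE (a +i* - b)%C) /=.
  rewrite (rmorphN (real_complex R)) mulrN.
  rewrite (rmorphXn (real_complex R)) rmorphXn rmorphB rmorphD rmorphM /=.
  set I := polyC 'i%C; set F := polyC _; set G := polyC _.
  have I2 : I ^+ 2 = -1 by rewrite /I -rmorphXn sqr_i rmorphN1.
  transitivity (('X - F) ^+ 2 - I ^+ 2 * G ^+ 2); last by ring.
  by rewrite I2; ring.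
(* One factor is split over the roots and the other over their conjugates, since [P] is fixed by
   conjugation. *)
have : p * p = (lead_coef p ^+ 2) *: \prod_(l <- s) quad l.
  apply: (map_inj_poly (f := f)); [exact: complexI|exact: rmorph0|].
  rewrite linearZ /= rmorphXn /= rmorph_prod /=.
  under eq_bigr do rewrite quadE.
  rewrite big_split /= rmorphM /= -/P -{2}conjP {1 2}Ps lP.
  rewrite map_polyZ /= rmorph_prod /= oppr0.
  under [X in _ * (_ *: X)]eq_bigr do rewrite conjX.
  by rewrite -scalerAl -scalerAr scalerA expr2.
move=> /(congr1 (pev A)); rewrite pevM Ap comp_lfun0l linearZ /= => /esym/eqP.
by rewrite scaler_eq0 expf_eq0 lead_coef_eq0 (negPf p0) andbF => /eqP.
Qed.

(* For self-adjoint [A] a quadratic factor with no real root is injective, and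
   [(A - a)^2 z = 0] forces [(A - a) z = 0], so simple real factors suffice. *)
Lemma spectrumP A : selfadjoint ip A -> exists t : seq R,
  [/\ uniq t, forall a, a \in t -> eigen A a
    & pev A (\prod_(a <- t) ('X - a%:P)) = 0].
Proof.
move=> sA; have [s As] := annihilating_quad A.
pose t := undup [seq a <- [seq complex.Re l | l <- s] | `[< eigen A a >]].
exists t; split=> [|a|]; first exact: undup_uniq.
  by rewrite mem_undup mem_filter => /andP[/asboolP].
set pi := \prod_(a <- t) _.
apply/lfunP => x; rewrite zero_lfunE.
pose sub a := A - a *: \1.
have subE a : pev A ('X - a%:P) = sub a by rewrite linearB /= pevX pevC.
have sasub a : selfadjoint ip (sub a).
  exact/selfadjointB/selfadjointZ/selfadjoint1.
(* The quadratic factors are peeled off one at a time from the vector [pev A pi x]. *)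
have kill s' : {subset s' <= s} ->
    pev A (\prod_(l <- s') quad l) (pev A pi x) = 0 -> pev A pi x = 0.
  elim: s' => [|l s' IHs] ss; first by rewrite big_nil pevC scale1r id_lfunE.
  have ls : l \in s by apply: ss; rewrite mem_head.
  rewrite big_cons pevM comp_lfunE; set z := pev A (\prod_(_ <- s') _) _ => lz.
  apply: IHs => [l' l's|]; first by apply: ss; rewrite in_cons l's orbT.
  (* Paired with [z], the equation [lz] becomes a vanishing sum of two non-negative terms. *)
  have subz : sub (complex.Re l) z = 0.
    apply: (ip_eq0 (ip := ip)); have := congr1 (ip z) lz.
    rewrite /quad linearD /= expr2 pevM subE pevC add_lfunE comp_lfunE.
    rewrite scale_lfunE id_lfunE ip0r !ipE -sasub => /eqP.
    rewrite paddr_eq0 ?ip_ge0//; first by move=> /andP[/eqP].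
    exact: mulr_ge0 (sqr_ge0 _) (ip_ge0 _).
  have [//|z0] := eqVneq z 0.
  have lt : complex.Re l \in t.
    rewrite mem_undup mem_filter map_f// andbT; apply/asboolP; exists z => //.
    by move: subz; rewrite /sub add_lfunE opp_lfunE scale_lfunE id_lfunE =>
      /subr0_eq.
  (* Since [pi] contains the factor of this eigenvalue, [z] lies in the range of [sub] as well as in
     its kernel, and these are orthogonal. *)
  have [w zw] : exists w, z = sub (complex.Re l) w.
    exists (pev A (\prod_(l' <- s') quad l') (pev A (\prod_(a <- rem
      (complex.Re l) t) ('X - a%:P)) x)).
    rewrite -subE -!comp_lfunE -!pevM /z /pi (big_rem _ lt) /= -comp_lfunE
      -pevM.
    by congr (pev A _ x); ring.
  apply: (ip_eq0 (ip := ip)).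
  by rewrite -/z {1}zw sasub subz ip0r.
by apply: (kill s) => //; rewrite As zero_lfunE.
Qed.

(** The difference vanishes on the spectrum, so it is a multiple of the annihilating product of
    simple factors. *)
Lemma pev_ext A p q : selfadjoint ip A ->
  (forall a, eigen A a -> p.[a] = q.[a]) -> pev A p = pev A q.
Proof.
move=> sA pq; have [t [ut et At]] := spectrumP sA.
have : all (root (p - q)) t.
  by apply/allP => a /et /pq; rewrite rootE !hornerE => ->; rewrite subrr.
rewrite -uniq_rootsE in ut => rt.
apply/subr0_eq; rewrite -linearB /=.
have [r ->] := uniq_roots_prod_XsubC rt ut.
by rewrite pevM At comp_lfun0r.
Qed.

(** Newton's scheme: a new node is corrected by a multiple of the polynomial vanishing at the old
    ones. *)
Lemma interpolation (f : R -> R) (t : seq R) : uniq t ->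
  exists p, forall a, a \in t -> p.[a] = f a.
Proof.
elim: t => [|a t IHt /= /andP[at_ /IHt[p pE]]]; first by exists 0.
pose pi := \prod_(b <- t) ('X - b%:P).
have pia : pi.[a] != 0 by rewrite -rootE root_prod_XsubC.
exists (p + ((f a - p.[a]) / pi.[a]) *: pi) => b; rewrite !hornerE in_cons.
move=> /predU1P[->|bt]; first by rewrite divfK// addrC subrK.
suff -> : pi.[b] = 0 by rewrite mulr0 addr0 pE.
by apply/eqP; rewrite -rootE root_prod_XsubC.
Qed.

(** On the finite spectrum every function is a polynomial, so square roots and inverses become
    values of [pev]. *)
Lemma pev_interp A (f : R -> R) : selfadjoint ip A ->
  exists p, forall a, eigen A a -> p.[a] = f a.
Proof.
move=> /spectrumP[t [ut _ At]]; have [p pE] := interpolation f ut.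
exists p => a [v v0 /(pev_eigen (\prod_(a <- t) ('X - a%:P)))].
rewrite At zero_lfunE => /esym/eqP; rewrite scaler_eq0 (negPf v0) orbF.
by rewrite -rootE root_prod_XsubC => /pE.
Qed.

Lemma psd_eigen_ge0 A a : psd ip A -> eigen A a -> 0 <= a.
Proof.
move=> [_ A0] [v v0 Av]; have := A0 v.
by rewrite Av ipZr pmulr_lge0// ip_gt0.
Qed.

Lemma pd_eigen_gt0 A a : pd ip A -> eigen A a -> 0 < a.
Proof.
move=> [_ A0] [v v0 Av]; have := A0 _ v0.
by rewrite Av ipZr pmulr_lgt0// ip_gt0.
Qed.

(** [pev A p] is the square of [pev A q], where [q] interpolates the square root of [p] on the
    spectrum. *)
Lemma psd_pev A p : selfadjoint ip A ->
  (forall a, eigen A a -> 0 <= p.[a]) -> psd ip (pev A p).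
Proof.
move=> sA p0; have [q qE] := pev_interp (fun a => Num.sqrt p.[a]) sA.
have -> : pev A p = pev A q \o pev A q.
  rewrite -pevM; apply: pev_ext sA _ => a ea.
  by rewrite hornerM qE// -expr2 sqr_sqrtr// p0.
exact/psd_sqr/selfadjoint_pev.
Qed.

Lemma psd_eigenP A : selfadjoint ip A -> (forall a, eigen A a -> 0 <= a) ->
  psd ip A.
Proof.
move=> sA A0; rewrite -(pevX A).
by apply: psd_pev => // a /A0; rewrite hornerX.
Qed.

Lemma lpowE A n : lpow A n = pev A 'X^n.
Proof.
by elim: n => [|n IHn]; rewrite ?pevC ?scale1r// exprSr pevMX -IHn.
Qed.

(** The closure hypothesis only raises a power by two, from [A^n] to [A A^n A], so the induction
    carries two consecutive powers. *)
Lemma pev_memv (H : {vspace 'End(X)}) A p : \1 \in H ->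
  (forall B C, B \in H -> C \in H -> B \o C \o B \in H) ->
  A \in H -> pev A p \in H.
Proof.
move=> H1 HQ HA; apply: memv_suml => i _; apply: memvZ.
suff [] : lpow A i \in H /\ lpow A i.+1 \in H by [].
elim: (nat_of_ord i) => [|n [Hn Hn1]]; first by rewrite /lpow /= comp_lfun1r.
split=> //; have := HQ _ _ HA Hn.
by rewrite -comp_lfunA lpowE -pev_comm -lpowE.
Qed.

End FunctionalCalculus.

(** * Square roots and orthogonal projection *)

Section SquareRoot.
Local Open Scope lfun_scope.
Context {R : realType} {X : vectType R} {ip : {dot X for idfun}}.
Implicit Types (A B C D P : 'End(X)) (x y z u v w : X) (a b c : R).

(* At an eigenvector [v] of [C - B] with eigenvalue [a], the form of
   [C^2 - B^2] equals [a (<v, C v> + <v, B v>)]. *)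
Lemma sqrt_le B C : psd ip B -> psd ip C ->
  loewner_le ip (B \o B) (C \o C) -> loewner_le ip B C.
Proof.
move=> pB pC BC; have [[sB B0] [sC C0]] := (pB, pC).
have sD := selfadjointB sC sB.
apply: psd_eigenP => // a [v v0 Dv].
have := loewner_leP v BC; rewrite !comp_lfunE -sB -sC.
have Cv : C v = B v + a *: v.
  by rewrite -Dv add_lfunE opp_lfunE addrC subrK.
have [//|a0] := leP 0 a.
have e : ip (C v) (C v) = ip (B v) (B v) + a * (ip v (C v) + ip v (B v)).
  by rewrite Cv !ipE (ipC (B v) v); ring.
rewrite e lerDl nmulr_rge0// => le0.
have /eqP : ip v (C v) + ip v (B v) = 0 by apply/le_anti; rewrite le0 addr_ge0.
rewrite paddr_eq0// => /andP[/eqP/(psd_ker pC) Cv0 /eqP/(psd_ker pB) Bv0].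
move/eqP: Cv; rewrite Cv0 Bv0 add0r eq_sym scaler_eq0 (negPf v0) orbF.
by rewrite lt_eqF.
Qed.

Lemma sqrt_inj B C : psd ip B -> psd ip C -> B \o B = C \o C -> B = C.
Proof.
move=> pB pC BC; apply/esym/subr0_eq/(psd_antisym (ip := ip)).
  by apply: sqrt_le => //; rewrite BC /loewner_le subrr; exact: psd0.
by rewrite opprB; apply: sqrt_le => //; rewrite BC /loewner_le subrr;
  exact: psd0.
Qed.

Lemma sqrt_pev A : psd ip A -> exists p, psd ip (pev A p) /\ pev A p \o pev A
  p = A.
Proof.
move=> pA; have [sA _] := pA; have [p pE] := pev_interp (@Num.sqrt R) sA.
exists p; split; first by apply: (psd_pev sA) => a /pE ->; exact: sqrtr_ge0.
rewrite -pevM -[RHS]pevX; apply: (pev_ext sA) => a ea.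
by rewrite hornerM hornerX pE// -expr2 sqr_sqrtr// (psd_eigen_ge0 pA).
Qed.

Lemma opsqrtP A : psd ip A ->
  psd ip (opsqrt ip A) /\ opsqrt ip A \o opsqrt ip A = A.
Proof.
move=> /sqrt_pev[p pA]; have /(xgetPex 0) : exists B,
  [set B : 'End(X) | psd ip B /\ B \o B = A] B by exists (pev A p).
exact.
Qed.

Lemma psd_opsqrt A : psd ip A -> psd ip (opsqrt ip A).
Proof. by move=> /opsqrtP[]. Qed.

Lemma opsqrtK A : psd ip A -> opsqrt ip A \o opsqrt ip A = A.
Proof. by move=> /opsqrtP[]. Qed.

Lemma opsqrt_sqr B : psd ip B -> opsqrt ip (B \o B) = B.
Proof.
move=> pB; have [? ?] := opsqrtP (psd_sqr (proj1 pB)).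
exact: sqrt_inj.
Qed.

Lemma pd_opsqrt A : pd ip A -> pd ip (opsqrt ip A).
Proof.
move=> pA; have [pB BB] := opsqrtP (pd_psd pA); have [sB B0] := pB.
split=> // x x0; rewrite lt_def B0 andbT.
apply/eqP => /(psd_ker pB) Bx; case: pA => _ /(_ x x0).
by rewrite -BB comp_lfunE Bx linear0 ip0r ltxx.
Qed.

Lemma opsqrt_le A B : psd ip A -> psd ip B -> loewner_le ip A B ->
  loewner_le ip (opsqrt ip A) (opsqrt ip B).
Proof.
move=> pA pB AB; apply: sqrt_le; rewrite ?opsqrtK//; exact: psd_opsqrt.
Qed.

Lemma adjointE A : selfadjoint ip A -> adjoint ip A = A.
Proof.
move=> sA; have /(xgetPex 0) aA : exists B,
  [set B : 'End(X) | forall x y, ip (A x) y = ip x (B y)] B by exists A.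
apply/lfunP => y; apply: (ip_inj (ip := ip)) => x.
by rewrite -[in LHS]aA sA.
Qed.

Lemma trnormE A : psd ip A -> trnorm ip A = optr A.
Proof.
by move=> pA; have [sA _] := pA; rewrite /trnorm adjointE// opsqrt_sqr.
Qed.

End SquareRoot.

(** * Orthogonal projection for the trace form *)

Section Projection.
Local Open Scope lfun_scope.
Context {R : realType} {X : vectType R} {ip : {dot X for idfun}}.
Variable H : {vspace 'End(X)}.
Hypothesis H_selfadjoint : forall A, A \in H -> selfadjoint ip A.
Implicit Types (A B C D P : 'End(X)) (x y z u v w : X) (a b c : R).

(** Encodes the functional [C |-> tr (A C)] on [H] by its values on a basis. *)
Let tr_coords A : 'rV[R]_(\dim H) := \row_i optr (A \o (vbasis H)`_i).

Let tr_coords_linear : linear tr_coords.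
Proof.
move=> a A B; apply/rowP => i; rewrite !mxE.
by rewrite comp_lfunDl -comp_lfunZl optrD optrZ.
Qed.
HB.instance Definition _ := GRing.isLinear.Build R 'End(X) 'rV[R]_(\dim H) _
  tr_coords tr_coords_linear.

Let tr_coordsE A B : (forall C, C \in H -> optr (A \o C) = optr (B \o C)) <->
  tr_coords A = tr_coords B.
Proof.
split=> [AB|/rowP AB C CH].
  by apply/rowP => i; rewrite !mxE AB// vbasis_mem// mem_nth ?size_tuple.
rewrite (coord_vbasis CH).
have e D : D \o (\sum_i coord (vbasis H) i C *: (vbasis H)`_i) =
    \sum_i coord (vbasis H) i C *: (D \o (vbasis H)`_i).
  rewrite (big_morph (comp_lfun D) (@comp_lfunDr _ _ _ _ D) (@comp_lfun0r _ _
    _ _ D)).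
  by apply: eq_bigr => i _; rewrite comp_lfunZr.
rewrite !e !optr_sum; apply: eq_bigr => i _; rewrite !optrZ.
by have := AB i; rewrite !mxE => ->.
Qed.

(** By definiteness [tr_coords] is injective on [H], hence onto by dimension; the projection is the
    preimage in [H] of the coordinates of [A]. *)
Lemma oproj_exists A : exists2 P, P \in H &
  forall B, B \in H -> optr (P \o B) = optr (A \o B).
Proof.
have cap0 : (H :&: lker (linfun tr_coords) = 0)%VS.
  apply/eqP; rewrite -subv0; apply/subvP => P;
    rewrite memv_cap memv_ker lfunE /=.
  move=> /andP[HP /eqP P0]; rewrite memv0; apply/eqP.
  have -> := @selfadjoint_sqr_eq0 _ _ ip P (H_selfadjoint HP) => //.
  have := (tr_coordsE P 0).2; rewrite P0 linear0 => /(_ erefl) ->//.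
  by rewrite comp_lfun0l optr0.
have img : (linfun tr_coords @: H)%VS = fullv.
  apply/eqP; rewrite eqEdim subvf limg_dim_eq// dimvf /dim /=.
  by rewrite mul1n.
have : linfun tr_coords A \in (linfun tr_coords @: H)%VS by rewrite img memvf.
move=> /memv_imgP[P HP]; rewrite !lfunE /= => /esym PA.
by exists P => //; apply/tr_coordsE.
Qed.

(** Two candidates differ by an element of [H] that is trace-orthogonal to [H], so its square has
    trace zero. *)
Lemma oproj_unique A P : P \in H ->
  (forall B, B \in H -> optr (P \o B) = optr (A \o B)) -> oproj ip H A = P.
Proof.
move=> HP PA; have AP : P \in H /\ forall B, B \in H -> ipop ip (A - P) B = 0.
  split=> // B HB; rewrite /ipop adjointE ?comp_lfunDl ?comp_lfunNl;
    last exact: H_selfadjoint.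
  by rewrite optrB PA// subrr.
have /(xgetPex 0)[HQ QA] : exists P, [set P : 'End(X) | P \in H /\
  forall B, B \in H -> ipop ip (A - P) B = 0] P by exists P.
rewrite -/(oproj ip H A) in HQ QA *.
have HD : oproj ip H A - P \in H by rewrite memvB.
have sD := H_selfadjoint HD.
apply/subr0_eq/(selfadjoint_sqr_eq0 sD).
have := AP.2 _ HD; have := QA _ HD; rewrite /ipop adjointE//.
set D := oproj ip H A - P => e1 e2.
have -> : D \o D = ((A - P) \o D) - ((A - oproj ip H A) \o D).
  by rewrite -comp_lfunNl -comp_lfunDl; congr (_ \o D);
    rewrite /D opprB [RHS]addrC addrA subrK.
by rewrite optrB e1 e2 subrr.
Qed.

Lemma oproj_memv A : oproj ip H A \in H.
Proof. by have [P HP PA] := oproj_exists A; rewrite (oproj_unique HP PA). Qed.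

Lemma optr_oproj A B : B \in H -> optr (oproj ip H A \o B) = optr (A \o B).
Proof.
by move=> HB; have [P HP PA] := oproj_exists A; rewrite (oproj_unique HP PA) PA.
Qed.

Lemma optr_oproj_out z B : B \in H -> optr (oproj ip H (out ip z) \o B) = ip z
  (B z).
Proof. by move=> HB; rewrite optr_oproj// optrC optr_out. Qed.

(* The projection fixes [e *: \1], so [pd] passes to its closure [psd]. *)
Lemma psd_oproj A : \1 \in H -> (forall A, pd ip A -> pd ip (oproj ip H A)) ->
  psd ip A -> psd ip (oproj ip H A).
Proof.
move=> H1 Hpd pA; split; first exact/H_selfadjoint/oproj_memv.
move=> x; rewrite leNgt; apply/negP => Px.
have [x0|x0] := eqVneq x 0; first by rewrite x0 ip0l ltxx in Px.
pose e := - ip x (oproj ip H A x) / ip x x.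
have e0 : 0 < e by rewrite divr_gt0 ?oppr_gt0 ?ip_gt0.
have := Hpd _ (pd_psdDr pA (pdZ1 e0)).
rewrite (@oproj_unique _ (oproj ip H A + e *: \1)); last first.
- by move=> B HB; rewrite !comp_lfunDl !optrD optr_oproj.
- by rewrite memvD ?memvZ// oproj_memv.
case=> _ /(_ x x0); rewrite add_lfunE scale_lfunE id_lfunE ipDr ipZr /e.
by rewrite divfK ?gt_eqF ?ip_gt0// subrr ltxx.
Qed.

End Projection.

(** * Completed squares under the trace *)

Section TraceInequalities.
Local Open Scope lfun_scope.
Context {R : realType} {X : vectType R} {ip : {dot X for idfun}}.
Implicit Types (A B C D J : 'End(X)).

Lemma comp_lfunBl A B C : (A - B) \o C = (A \o C) - (B \o C).
Proof. by rewrite comp_lfunDl comp_lfunNl. Qed.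

Lemma comp_lfunBr A B C : C \o (A - B) = (C \o A) - (C \o B).
Proof. by rewrite comp_lfunDr comp_lfunNr. Qed.

Lemma optr_inv_sqrB B J C : B \o J = \1 -> J \o B = \1 ->
  optr (J \o ((C - B) \o (C - B))) =
  optr (J \o (C \o C)) - 2 * optr C + optr B.
Proof.
move=> BJ JB.
rewrite !(comp_lfunBl, comp_lfunBr) !optrB !comp_lfunA JB !comp_lfun1l.
by rewrite (optrC (J \o C) B) comp_lfunA BJ comp_lfun1l; ring.
Qed.

Lemma conj_invB B J C : B \o J = \1 -> J \o B = \1 ->
  (J - C) \o B \o (J - C) = J - 2 *: C + (C \o B \o C).
Proof.
move=> BJ JB; rewrite !comp_lfunBl JB comp_lfun1l !comp_lfunBr.
rewrite -(comp_lfunA C B J) BJ comp_lfun1r.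
by rewrite scaler_nat mulr2n !opprD !opprK !addrA.
Qed.

(* [2 (C^2 - B^2) = (C + B) (C - B) + (C - B) (C + B)]. *)
Lemma optr_inv_sub_sqr B C : pd ip (C + B) ->
  optr ((C + B)^-1 \o ((C \o C) - (B \o B))) = optr C - optr B.
Proof.
move=> pS; set T := (C + B)^-1.
suff e : 2 *: ((C \o C) - (B \o B)) = ((C + B) \o (C - B)) + ((C - B) \o (C +
  B)).
  apply: (mulfI (_ : 2 != 0 :> R)); first by rewrite pnatr_eq0.
  rewrite -optrZ comp_lfunZr e [T \o _]comp_lfunDr optrD.
  rewrite (optrC _ (_ \o (C + B))) -(comp_lfunA (C - B)) (pd_invr pS)
    comp_lfun1r.
  by rewrite comp_lfunA (pd_invl pS) comp_lfun1l -optrB mulr2n mulrDl mul1r.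
rewrite !comp_lfunDl !comp_lfunBr !comp_lfunDr !comp_lfunNl scaler_nat mulr2n.
move: (C \o C) (C \o B) (B \o C) (B \o B) => cc cb bc bb.
rewrite [RHS]addrACA [cc - cb + _]addrACA addNr addr0.
by rewrite [bc - bb + _]addrACA subrr add0r addrACA.
Qed.

(** Concavity of the trace of the square root: both differences are the trace of the same psd
    increment against [(B' + B)^-1] and [(C' + C)^-1], and inversion reverses the order. *)
Lemma optr_sqrtB_le B B' C C' : pd ip B -> pd ip C -> psd ip B' -> psd ip C' ->
  loewner_le ip C B -> loewner_le ip C' B' ->
  psd ip ((C' \o C') - (C \o C)) ->
  (B' \o B') - (B \o B) = (C' \o C') - (C \o C) ->
  optr B' - optr B <= optr C' - optr C.
Proof.
move=> pB pC pB' pC' CB CB' pD DE.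
have pBB := pd_psdDr pB' pB; have pCC := pd_psdDr pC' pC.
rewrite -(optr_inv_sub_sqr pBB) -(optr_inv_sub_sqr pCC) DE.
rewrite 2!(optrC _ (_ - _)); apply: (optr_psd_mul_le (ip := ip)) => //.
apply: pd_inv_le => //; rewrite /loewner_le opprD addrACA.
exact: psdD.
Qed.

End TraceInequalities.

(** * Weighted norms, operator norm and uniqueness of gradients *)

Section NormsAndGradients.
Local Open Scope lfun_scope.
Context {R : realType} {X : vectType R} {ip : {dot X for idfun}}.
Implicit Types (A : 'End(X)) (u v w x y z : X) (a r : R).

Lemma wnorm2D A u v : psd ip A ->
  wnorm2 ip A (u + v) <= 2 * wnorm2 ip A u + 2 * wnorm2 ip A v.
Proof.
move=> [sA A0]; have := A0 (u - v); rewrite /wnorm2 linearB linearD /= !ipE.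
lra.
Qed.

Lemma wnorm2Z A a u : wnorm2 ip A (a *: u) = a ^+ 2 * wnorm2 ip A u.
Proof. by rewrite /wnorm2 linearZ /= ipZl ipZr mulrA. Qed.

Lemma opnorm_ub A x : psd ip A -> enorm ip (A x) <= opnorm ip A * enorm ip x.
Proof.
move=> pA; have [sA _] := pA; rewrite /opnorm; set E := [set _ | _ in _].
have ubE : has_ubound E.
  (* With [c = tr A^2], the squared norm is at most [c], which is below [(c + 1)^2]. *)
  exists (optr (A \o A) + 1) => _ [y y1 <-].
  have c0 := optr_ge0 (psd_sqr sA).
  have := psd_le_optr y (psd_sqr sA); rewrite comp_lfunE -sA -!enorm_sqr => h.
  rewrite -(@ler_pXn2r _ 2) ?nnegrE ?enorm_ge0 ?addr_ge0//.
  apply: (le_trans h); apply: (@le_trans _ _ (optr (A \o A))).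
    by rewrite ler_piMr// expr_le1 ?enorm_ge0.
  by move: c0; set c := optr _ => c0; nra.
have [->|x0] := eqVneq x 0; first by rewrite linear0 !enorm0 mulr0.
have n0 : 0 < enorm ip x by rewrite sqrtr_gt0 ip_gt0.
rewrite -ler_pdivrMr// mulrC -enormZ ?invr_ge0 ?(ltW n0)// -linearZ.
apply: (ub_le_sup ubE); exists ((enorm ip x)^-1%R *: x) => //=.
by rewrite enormZ ?invr_ge0 ?(ltW n0)// mulVf// gt_eqF.
Qed.

Lemma opnorm_le A r : 0 <= r ->
  (forall x, ip (A x) (A x) <= r ^+ 2 * ip x x) -> opnorm ip A <= r.
Proof.
move=> r0 Ar; apply: ge_sup => [|_ [x x1 <-]].
  by exists (enorm ip (A 0)), 0; rewrite //= enorm0.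
rewrite -(@ler_pXn2r _ 2) ?nnegrE ?enorm_ge0// enorm_sqr.
apply: (le_trans (Ar x)); rewrite ler_piMr ?sqr_ge0// -enorm_sqr.
by rewrite expr_le1 ?enorm_ge0.
Qed.

(** Along a short step in the direction [w = z - z'] the two expansions differ by [|w|] per unit
    length, more than twice the tolerance [|w| / 3]. *)
Lemma is_gradient_unique (f : X -> R) x z z' :
  is_gradient ip f x z -> is_gradient ip f x z' -> z = z'.
Proof.
move=> fz fz'; apply/subr0_eq/(ip_eq0 (ip := ip)); set w := z - z'.
have w0 := enorm_ge0 (ip := ip) w.
rewrite -enorm_sqr; apply/eqP; rewrite sqrf_eq0 -[_ == 0]negbK;
  apply/negP => wn0.
have wp : 0 < enorm ip w by rewrite lt_def wn0.
pose e := enorm ip w / 3.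
have e0 : 0 < e by rewrite divr_gt0.
have [d d0 dz] := fz e e0; have [d' d'0 dz'] := fz' e e0.
(* Chosen so that the step [t w] has half the length of the smaller radius. *)
pose t := Num.min d d' / (2 * enorm ip w).
have t0 : 0 < t by rewrite divr_gt0 ?mulr_gt0// lt_min d0.
have ty : enorm ip (t *: w) = Num.min d d' / 2.
  by rewrite enormZ ?(ltW t0)// /t; field; rewrite gt_eqF.
have m0 : 0 < Num.min d d' by rewrite lt_min d0.
have ltm : enorm ip (t *: w) < Num.min d d' by rewrite ty; lra.
have := dz (t *: w); have := dz' (t *: w).
move: ltm; rewrite lt_min => /andP[l1 l2] /(_ l2) + /(_ l1).
rewrite !ler_norml => /andP[h1 h2] /andP[h3 h4].
have : ip w (t *: w) <= 2 * e * enorm ip (t *: w).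
  by rewrite {1}/w ipDl ipNl; lra.
rewrite enormZ ?(ltW t0)// ipZr -enorm_sqr mulrCA ler_pM2r;
  last exact: mulr_gt0.
by rewrite /e; lra.
Qed.

Lemma gradE (f : X -> R) x z : is_gradient ip f x z -> grad ip f x = z.
Proof.
move=> fz; have /(xgetPex 0) fz' : exists z, [set z | is_gradient ip f x z] z.
  by exists z.
exact: is_gradient_unique fz' fz.
Qed.

Lemma is_gradientZ (f : X -> R) x z a : 0 < a -> is_gradient ip f x z ->
  is_gradient ip (fun y => a * f y) x (a *: z).
Proof.
move=> a0 fz e e0; have [d d0 dz] := fz (e / a) (divr_gt0 e0 a0).
exists d => // y /dz; rewrite ipZl -!mulrBr normrM (gtr0_norm a0).
by rewrite mulrAC ler_pdivlMr// mulrC.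
Qed.

End NormsAndGradients.

(** * The trace regularizer *)

Section Regularizer.
Local Open Scope lfun_scope.
Context {R : realType} {X : vectType R} {ip : {dot X for idfun}}.
Variable H : {vspace 'End(X)}.
Hypothesis H_selfadjoint : forall A, A \in H -> selfadjoint ip A.
Hypothesis H_id : (\1%VF : 'End(X)) \in H.
Hypothesis H_quad : forall A B, A \in H -> B \in H -> (A \o B \o A)%VF \in H.
Hypothesis H_proj : forall A, pd ip A -> pd ip (oproj ip H A).
Implicit Types (A B C D S : 'End(X)) (m n z u v w x y : X) (a b c r : R).

(** The square root is a polynomial in [A]; the same holds for the inverse below. *)
Lemma opsqrt_memv A : A \in H -> psd ip A -> opsqrt ip A \in H.
Proof.
move=> HA /sqrt_pev[p [pB BB]].
by rewrite -{1}BB opsqrt_sqr// pev_memv.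
Qed.

Lemma inv_memv A : A \in H -> pd ip A -> A^-1 \in H.
Proof.
move=> HA pA; have [p pE] := pev_interp (fun a => a^-1%R) (H_selfadjoint HA).
suff e : A \o pev A p = \1.
  have -> : A^-1 = pev A p.
    by rewrite -[RHS]comp_lfun1l -(pd_invl pA) -comp_lfunA e comp_lfun1r.
  exact: pev_memv.
rewrite -pevMX -[RHS]scale1r -(pevC A); apply: (pev_ext (H_selfadjoint HA)) =>
  a ea.
by rewrite hornerMX hornerC pE// mulVf// gt_eqF// (pd_eigen_gt0 pA ea).
Qed.

Let P m := oproj ip H (out ip m).

Let P_memv m : P m \in H. Proof. exact: oproj_memv. Qed.

Let psd_P m : psd ip (P m).
Proof. by apply: psd_oproj => //; exact: psd_out. Qed.

Let optr_P m A : A \in H -> optr (P m \o A) = ip m (A m).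
Proof. exact: optr_oproj_out. Qed.

(* Locked: [ring] and [lra] would otherwise unfold it when comparing atoms. *)
Fact regroot_key : unit. Proof. by []. Qed.
Definition regroot := locked_with regroot_key
  (fun S m => opsqrt ip (oproj ip H (out ip m) + S)).

Lemma regrootE S m : regroot S m = opsqrt ip (oproj ip H (out ip m) + S).
Proof. by rewrite /regroot unlock. Qed.

Definition invregroot S m : 'End(X) := (regroot S m)^-1.

Section Root.
Variable S : 'End(X).
Hypotheses (S_in : S \in H) (S_pd : pd ip S).

Local Notation J := (invregroot S).

Lemma pd_reg m : pd ip (P m + S). Proof. exact: pd_psdDr. Qed.

Lemma pd_root m : pd ip (regroot S m).
Proof. by rewrite regrootE; exact/pd_opsqrt/pd_reg. Qed.

Lemma rootK m : regroot S m \o regroot S m = P m + S.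
Proof. by rewrite regrootE; exact/opsqrtK/pd_psd/pd_reg. Qed.

Lemma root_memv m : regroot S m \in H.
Proof. by rewrite regrootE; apply: opsqrt_memv;
  [exact: memvD (P_memv m) S_in|exact/pd_psd/pd_reg]. Qed.

Lemma pd_invroot m : pd ip (J m). Proof. exact/pd_inv/pd_root. Qed.

Lemma invroot_memv m : J m \in H.
Proof. by apply: inv_memv; [exact: root_memv|exact: pd_root]. Qed.

Let rootJ m : regroot S m \o J m = \1. Proof. exact/pd_invr/pd_root. Qed.
Let Jroot m : J m \o regroot S m = \1. Proof. exact/pd_invl/pd_root. Qed.

(** With [B] the root, [tr B = tr (B^2 J)], and the projection inside [B^2] drops out against [J] in
    [H]. *)
Lemma optr_root m : optr (regroot S m) = ip m (J m m) + optr (S \o J m).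
Proof.
rewrite -[regroot S m]comp_lfun1r -(rootJ m) comp_lfunA rootK comp_lfunDl optrD.
by rewrite optr_P// invroot_memv.
Qed.

Lemma optr_reg_invroot_conj m A : optr ((P m + S) \o (J m \o A \o J m)) = optr
  A.
Proof.
rewrite optrC -rootK !comp_lfunA -[X in X \o regroot S m]comp_lfunA Jroot
  comp_lfun1r.
by rewrite -comp_lfunA optrC -comp_lfunA rootJ comp_lfun1r.
Qed.

Lemma root_upper m n : optr (regroot S n) <=
  optr (regroot S m) + (ip n (J m n) - ip m (J m m)) / 2.
Proof.
have [sm _] := pd_root m; have [sn _] := pd_root n.
have := optr_psd_mul (pd_psd (pd_invroot m)) (psd_sqr (selfadjointB sn sm)).
rewrite (optr_inv_sqrB _ (rootJ m) (Jroot m)) rootK optrC comp_lfunDl optrD.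
rewrite optr_P ?invroot_memv// (optr_root m).
lra.
Qed.

(** With [D = J n - J m] and [B] the root at [n], add [|J n n - J m m|^2 >= 0] in the form of [B]
    and [tr (S D B D) >= 0]. The terms in [J m B J m] then combine to
    [tr ((P m + S) J m B J m) = tr B]. *)
Lemma root_lower m n : optr (regroot S m) + ip (n - m) (J m m) <= optr
  (regroot S n).
Proof.
have pn := pd_psd (pd_root n).
have [sJm _] := pd_invroot m; have [sJn _] := pd_invroot n.
have sD := selfadjointB sJn sJm.
have pF := psd_conj sD pn.
have h2 := optr_psd_mul (pd_psd S_pd) pF.
have h1 := pn.2 (J n n - J m m).
rewrite linearB /= -[regroot S n (J n n)]comp_lfunE rootJ id_lfunE in h1.
have e1 : ip (J n n - J m m) (n - regroot S n (J m m)) =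
    ip n (J n n) - 2 * ip n (J m m) + ip m ((J m \o regroot S n \o J m) m).
  have Jw w : J n (regroot S n w) = w by rewrite -comp_lfunE Jroot id_lfunE.
  rewrite !ipE !sJn !sJm Jw !comp_lfunE (ipC n (J m m)) sJm.
  by ring.
rewrite e1 in h1; rewrite (conj_invB _ (rootJ n) (Jroot n)) in h2.
rewrite comp_lfunDr comp_lfunBr -comp_lfunZr !(optrD, optrN, optrZ) in h2.
have HF : J m \o regroot S n \o J m \in H.
  exact: H_quad (invroot_memv m) (root_memv n).
have := optr_reg_invroot_conj m (regroot S n).
rewrite comp_lfunDl optrD optr_P//.
rewrite ipDl ipNl !optr_root in h2 *.
lra.
Qed.

Lemma opsqrt_le_root m : loewner_le ip (opsqrt ip S) (regroot S m).
Proof.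
rewrite regrootE; apply: opsqrt_le; [exact: pd_psd|exact/pd_psd/pd_reg|].
by rewrite /loewner_le addrK; exact: psd_P.
Qed.

Lemma invroot_le m : loewner_le ip (J m) ((opsqrt ip S)^-1).
Proof.
apply: pd_inv_le; [exact: pd_opsqrt|exact: pd_root|exact: opsqrt_le_root].
Qed.

(* The Bregman divergence dominates the squared dual distance of the
   gradients because the smoothness estimate [root_upper] applies with
   [J <= (sqrt S)^-1]: compare both bounds at [n - sqrt S w]. *)
Lemma root_bregman m n (w := J n n - J m m) :
  optr (regroot S m) + ip (n - m) (J m m) + ip w (opsqrt ip S w) / 2 <=
  optr (regroot S n).
Proof.
have wE : w = J n n - J m m by []; clearbody w.
pose C := opsqrt ip S; rewrite -/C.
have pC : pd ip C by exact: pd_opsqrt.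
have [sJn _] := pd_invroot n; have [sC _] := pC.
pose z := n - C w.
have lo := root_lower m z; have up := root_upper n z.
have CVC : (C^-1)%VF (C w) = w by rewrite -comp_lfunE (pd_invl pC) id_lfunE.
have := loewner_leP (C w) (invroot_le n); rewrite -/C CVC => Jle.
have e1 : ip z (J n z) = ip n (J n n) - 2 * ip (C w) (J n n) + ip (C w) (J n
  (C w)).
  by rewrite /z linearB /= !ipE -[ip n (J n (C w))]sJn (ipC (J n n)); ring.
have e2 : ip (z - m) (J m m) = ip (n - m) (J m m) - ip (C w) (J m m).
  by rewrite /z !ipE; ring.
have e3 : ip (C w) (J n n) - ip (C w) (J m m) = ip w (C w).
  by rewrite -ipNr -ipDr -wE ipC.
rewrite e2 in lo; rewrite e1 in up; rewrite (ipC (C w) w) in Jle.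
lra.
Qed.

(** [root_lower] and [root_upper] enclose the remainder between 0 and [<h, J h> / 2], which is at
    most [tr J |h|^2 / 2]. *)
Lemma is_gradient_root m : is_gradient ip (fun m => optr (regroot S m)) m (J m
  m).
Proof.
move=> e e0; pose c := optr (J m).
have c0 : 0 <= c by exact/optr_ge0/pd_psd/pd_invroot.
exists (e / (c + 1)); first by rewrite divr_gt0// ltr_pwDr.
move=> h; rewrite ltr_pdivlMr ?ltr_pwDr// => hd.
have lo := root_lower m (m + h); have up := root_upper m (m + h).
have [sJ _] := pd_invroot m.
rewrite [m + h - m]addrC addKr (ipC h) in lo.
have e1 : ip (m + h) (J m (m + h)) = ip m (J m m) + 2 * ip (J m m) h + ip h (J
  m h).
  by rewrite linearD /= !ipE -[ip m (J m h)]sJ (ipC h (J m m)); ring.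
rewrite e1 in up.
have := psd_le_optr h (pd_psd (pd_invroot m)); rewrite -/c -enorm_sqr => hJ.
have n0 := enorm_ge0 (ip := ip) h.
rewrite ger0_norm; last by lra.
have : c * enorm ip h ^+ 2 <= e * enorm ip h.
  rewrite expr2 mulrA ler_wpM2r//; lra.
lra.
Qed.

End Root.

Lemma Psi_starE eta S m : pd ip S ->
  Psi_star ip H eta S m = eta * optr (regroot S m).
Proof.
by move=> pS; rewrite /Psi_star -regrootE trnormE//; exact/pd_psd/pd_root.
Qed.

Lemma grad_Psi_star eta S m : 0 < eta -> S \in H -> pd ip S ->
  grad ip (Psi_star ip H eta S) m = eta *: invregroot S m m.
Proof.
move=> eta0 HS pS; apply: gradE.
have -> : Psi_star ip H eta S = fun y => eta * optr (regroot S y).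
  by apply/funext => y; rewrite Psi_starE.
exact/is_gradientZ/is_gradient_root.
Qed.

(** * Change of the regularizer at a fixed dual point *)

Section Drift.
Variables S S' : 'End(X).
Hypotheses (S_in : S \in H) (S_pd : pd ip S).
Hypotheses (S'_in : S' \in H) (S'_pd : pd ip S') (SS' : loewner_le ip S S').

Lemma root_drift m (w := invregroot S' m m - invregroot S m m) :
  ip w (opsqrt ip S' w) <= optr (regroot S' m) - optr (regroot S m).
Proof.
have pB := pd_root S_pd m; have pB' := pd_root S'_pd m.
have [HJ HJ'] := (invroot_memv S_in S_pd m, invroot_memv S'_in S'_pd m).
pose J := invregroot S m; pose J' := invregroot S' m.
have [[sJ _] [sJ' _]] := (pd_inv pB, pd_inv pB').
have le1 : ip w (opsqrt ip S' w) <= ip w (regroot S' m w).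
  exact/loewner_leP/opsqrt_le_root.
apply: le_trans le1 _.
set F := J' - 2 *: J + (J \o regroot S' m \o J).
have Fw : ip w (regroot S' m w) = ip m (F m).
  rewrite /F -(conj_invB _ (pd_invr pB') (pd_invl pB')) !comp_lfunE.
  by rewrite -(selfadjointB sJ' sJ) add_lfunE opp_lfunE.
have HF : F \in H.
  rewrite memvD ?memvB ?memvZ//; apply: H_quad => //; exact: root_memv.
have pF : psd ip F.
  rewrite /F -(conj_invB _ (pd_invr pB') (pd_invl pB')).
  by apply: psd_conj (pd_psd pB'); exact: selfadjointB.
(* Adding [tr (F S) >= 0] completes [P m] to the square of the root, against which [J] cancels. *)
have le2 : ip m (F m) <= optr (F \o (P m + S)).
  rewrite comp_lfunDr optrD (optrC F (P m)) optr_P// lerDl.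
  exact: optr_psd_mul pF (pd_psd S_pd).
rewrite Fw; apply: le_trans le2 _.
rewrite /F comp_lfunDl comp_lfunBl -comp_lfunZl !(optrD, optrN, optrZ).
rewrite (optrC (J \o _ \o _)) optr_reg_invroot_conj// -!rootK//.
have [JB BJ] : J \o regroot S m = \1 /\ regroot S m \o J = \1.
  by split; [exact: (pd_invl pB)|exact: (pd_invr pB)].
rewrite (comp_lfunA J) JB comp_lfun1l.
have : optr ((regroot S m \o regroot S m) \o J') <= optr ((regroot S m \o
  regroot S m) \o J).
  apply: optr_psd_mul_le; first exact: psd_sqr pB.1.
  apply: pd_inv_le => //; rewrite !regrootE; apply: opsqrt_le;
    [exact/pd_psd/pd_reg|exact/pd_psd/pd_reg|].
  exact: loewner_leD.
rewrite -(comp_lfunA _ _ J) BJ comp_lfun1r (optrC _ J').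
lra.
Qed.

(** Both differences of squares equal [S' - S], and the roots at [m] dominate those at 0, so
    concavity applies. *)
Lemma optr_rootB_le m : optr (regroot S' m) - optr (regroot S m) <=
  optr (opsqrt ip S') - optr (opsqrt ip S).
Proof.
have [pC pC'] := (pd_opsqrt S_pd, pd_opsqrt S'_pd).
have [pS pS'] := (pd_psd S_pd, pd_psd S'_pd).
have [pB pB'] := (pd_root S_pd m, pd_psd (pd_root S'_pd m)).
apply: (optr_sqrtB_le pB pC pB' (pd_psd pC')); try exact: opsqrt_le_root.
  by rewrite !opsqrtK.
by rewrite !rootK// !opsqrtK// opprD addrACA subrr add0r.
Qed.

End Drift.

(** The bound on [rho] says that [P u] is at most [r^2] times the identity; this is traced against
    [A]. *)
Lemma rho_ball_ip_le u r A : 0 <= r -> rho_ball ip H r u -> A \in H ->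
  psd ip A ->
  ip u (A u) <= r ^+ 2 * optr A.
Proof.
move=> r0 ru HA pA; rewrite -(optr_P u HA) -[A in X in _ <= X]comp_lfun1l.
rewrite comp_lfun1l -[A in X in _ <= X]comp_lfun1r -optrZ comp_lfunZr optrC.
apply: (optr_psd_mul_le pA); split.
  by apply/selfadjointB/H_selfadjoint/P_memv/selfadjointZ/selfadjoint1.
move=> x; rewrite add_lfunE opp_lfunE scale_lfunE id_lfunE ipDr ipNr ipZr
  subr_ge0.
have [pT TT] := opsqrtP (psd_P u); have [sT _] := pT.
rewrite -{1}TT comp_lfunE -sT -!enorm_sqr -exprMn ler_pXn2r ?nnegrE
  ?enorm_ge0//.
  by apply: le_trans (opnorm_ub x pT) _; rewrite ler_wpM2r ?enorm_ge0.
by rewrite mulr_ge0 ?enorm_ge0.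
Qed.

(* [N^+] is the pseudo-inverse of [N = sqrt (P m)]: since [m] lies in the range
   of [N], Cauchy-Schwarz for the form of [N] applies to [m = N (N^+ m)]. *)
Lemma dual_normP m r : 0 <= r -> let N := opsqrt ip (P m) in
  (forall u, rho_ball ip H r u -> ip m u <= r * optr N) /\
  exists2 u, rho_ball ip H r u & ip m u = r * optr N.
Proof.
move=> r0 N; have pP := psd_P m.
have [pN NN] := opsqrtP pP; rewrite -/N in pN NN.
have [sN N0] := pN.
have HN : N \in H by exact: opsqrt_memv.
(* As [0^-1 = 0] by convention, [q] sends the eigenvalue 0 to 0 and [V] is the pseudo-inverse. *)
have [q qE] := pev_interp (fun a => a^-1%R) sN.
pose V := pev N q; have HV : V \in H by exact: pev_memv.
have pV : psd ip V.
  apply: psd_pev sN _ => a ea; rewrite qE// invr_ge0.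
  exact: psd_eigen_ge0 pN ea.
have NV : N \o V = V \o N by exact: pev_comm.
have NVN : N \o V \o N = N.
  rewrite -comp_lfunA -NV /V -!pevMX -[RHS]pevX; apply: (pev_ext sN) => a ea.
  rewrite !hornerMX hornerX qE//; have [->|a0] := eqVneq a 0;
    first by rewrite !mulr0.
  by rewrite mulVf// mul1r.
have VNV : V \o N \o V = V.
  rewrite -NV -comp_lfunA /V -pevM -pevMX; apply: (pev_ext sN) => a ea.
  rewrite hornerMX hornerM qE//; have [->|a0] := eqVneq a 0;
    first by rewrite invr0 !mulr0.
  by rewrite -mulrA mulVf// mulr1.
have trV : ip m (V m) = optr N.
  by rewrite -optr_P// -NN -comp_lfunA NV comp_lfunA NVN.
have mE : m = N (V m).
  (* [E] projects onto the kernel of [N]; it lies in [H], so [|E m|^2 = tr (N^2 E^2)], which is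
     0. *)
  pose E := \1 - (N \o V).
  have HE : E \in H by rewrite memvB// -pevMX; exact: pev_memv.
  have NE : N \o E = 0 by rewrite comp_lfunBr comp_lfun1r comp_lfunA
    -comp_lfunA NV comp_lfunA NVN subrr.
  have Em : E m = 0.
    apply: (ip_eq0 (ip := ip)); rewrite (H_selfadjoint HE) -comp_lfunE.
    rewrite -[E in E \o _]comp_lfun1r -optr_P ?H_quad// -NN comp_lfun1r.
    by rewrite -comp_lfunA (comp_lfunA N E) NE comp_lfun0l comp_lfun0r optr0.
  by move: Em; rewrite add_lfunE opp_lfunE id_lfunE comp_lfunE => /subr0_eq.
pose F := N \o V; have FF : F \o F = F by rewrite /F comp_lfunA NVN.
have HF : F \in H by rewrite /F -pevMX; exact: pev_memv.
have sF := H_selfadjoint HF; have pF : psd ip F by rewrite -FF; exact: psd_sqr.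
have trN := optr_ge0 pN.
split=> [u ru|].
  have := psd_CauchySchwarz (V m) u pN.
  rewrite -sN -mE (ipC (V m)) trV => h1.
  have h2 := rho_ball_ip_le r0 ru HN pN.
  rewrite leNgt; apply/negP => lt.
  have : (r * optr N) ^+ 2 < ip m u ^+ 2.
    by rewrite ltr_pXn2r ?nnegrE ?mulr_ge0//; apply: le_trans (ltW lt);
      exact: mulr_ge0.
  rewrite ltNge => /negP; apply; apply: (le_trans h1).
  by rewrite exprMn expr2 mulrCA ler_wpM2l.
exists (r *: V m); last by rewrite ipZr trV.
(* The projection of [out (r V m)] is [r^2 F]: tested against [B] in [H], it gives
   [r^2 tr (V N^2 V B) = r^2 tr (F B)]. *)
have -> : rho_ball ip H r (r *: V m) = (opnorm ip (r *: F) <= r) :> Prop.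
  rewrite /rho_ball /rho /=.
  rewrite (@oproj_unique _ _ ip H H_selfadjoint _ (r ^+ 2 *: F)) ?memvZ//.
    rewrite -[in RHS](opsqrt_sqr (psdZ r0 pF)).
    by rewrite -comp_lfunZl -comp_lfunZr scalerA FF expr2.
  move=> B HB; rewrite outZ -!comp_lfunZl !optrZ; congr (_ * _).
  have sV := pV.1.
  rewrite [RHS]optrC optr_out sV -!comp_lfunE -optr_P ?H_quad// -NN.
  rewrite [RHS]optrC -comp_lfunA (comp_lfunA V N N) -NV NVN.
  by rewrite [RHS]optrC comp_lfunA.
apply: opnorm_le => // x.
rewrite scale_lfunE !ipE mulrA -expr2 ler_wpM2l ?sqr_ge0//.
have := ip_ge0 (ip := ip) (x - F x).
have -> : ip (F x) (F x) = ip x (F x) by rewrite sF -comp_lfunE FF.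
rewrite !ipE (ipC (F x) x) sF -comp_lfunE FF; lra.
Qed.

(** * Regret *)

Section Regret.
Variables (eta : R) (S : nat -> 'End(X)) (K : nat) (g x : nat -> X).
Hypotheses (eta0 : 0 < eta) (S_in : forall k, S k \in H).
Hypotheses (S_pd : forall k, pd ip (S k)).
Hypothesis S_mono : forall k, loewner_le ip (S k) (S k.+1).
(** Only the first [n] vectors are summed, so the dual point of step [k] is [M k.+1]. *)
Let M (n : nat) := \sum_(i < n) g i.
Hypothesis x_init : x 0%N = 0.
Hypothesis x_step : forall k : nat, (k <= K)%N ->
  x k.+1 = - (eta *: invregroot (S k) (M k.+1) (M k.+1)).

Let f k j := optr (regroot (S k) (M j)).
(** An intermediate point: the new regularizer [S k] at the old dual point [M k]. *)
Let y k := - (eta *: invregroot (S k) (M k) (M k)).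

(** The Bregman term pays for [|x k.+1 - y k|^2 / (2 eta)]; splitting [x k.+1 - x k] at [y k]
    doubles squares and leaves the factor 1/4. *)
Lemma regret_step k : (k <= K)%N ->
  ip (g k) (x k.+1) + 1 / (4 * eta) * wnorm2 ip (opsqrt ip (S k)) (x k.+1 - x k)
  <= eta * (f k k - f k k.+1) +
     1 / (2 * eta) * wnorm2 ip (opsqrt ip (S k)) (y k - x k).
Proof.
move=> kK; have pC := pd_psd (pd_opsqrt (S_pd k)).
have := root_bregman (S_in k) (S_pd k) (M k.+1) (M k).
set w := invregroot (S k) (M k) (M k) - _ => br.
have gE : M k - M k.+1 = - g k by rewrite /M big_ord_recr /= opprD addrA subrr
  add0r.
rewrite gE ipNl -!/(f _ _) in br.
have xE : x k.+1 - y k = eta *: w.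
  by rewrite (x_step kK) /y opprK /w scalerBr addrC.
have := wnorm2D (x k.+1 - y k) (y k - x k) pC.
rewrite addrA subrK xE wnorm2Z /wnorm2.
have -> : ip (g k) (x k.+1) = - (eta * ip (g k) (invregroot (S k) (M k.+1) (M
  k.+1))).
  by rewrite (x_step kK) ipNr ipZr.
move: br.
set F1 := f k k.+1; set F0 := f k k.
set a := ip w _; set b := ip (x _ - x _) _; set c := ip (y _ - _) _.
set d := ip (g k) _ => br par.
have : 1 / (4 * eta) * b <= 1 / (4 * eta) * (2 * (eta ^+ 2 * a) + 2 * c).
  by rewrite ler_wpM2l// divr_ge0// mulr_ge0// ltW.
have -> : 1 / (4 * eta) * (2 * (eta ^+ 2 * a) + 2 * c) =
    eta * (a / 2) + 1 / (2 * eta) * c by field; rewrite gt_eqF.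
have : eta * (F1 - d + a / 2) <= eta * F0 by rewrite ler_wpM2l// ltW.
lra.
Qed.

(** [x k.+1] and [y k.+1] share the dual point and differ only in the regularizer. *)
Lemma regret_drift k : (k < K)%N ->
  1 / (2 * eta) * wnorm2 ip (opsqrt ip (S k.+1)) (y k.+1 - x k.+1) <=
  eta / 2 * (f k.+1 k.+1 - f k k.+1).
Proof.
move=> kK.
have := root_drift (S_in k) (S_pd k) (S_in k.+1) (S_pd k.+1) (S_mono k) (M
  k.+1).
set w := invregroot (S k.+1) _ _ - _ => dr.
have -> : y k.+1 - x k.+1 = - eta *: w.
  by rewrite (x_step (ltnW kK)) /y opprK /w scaleNr scalerBr opprB addrC.
rewrite wnorm2Z sqrrN.
have -> : 1 / (2 * eta) * (eta ^+ 2 * wnorm2 ip (opsqrt ip (S k.+1)) w) =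
  eta / 2 * wnorm2 ip (opsqrt ip (S k.+1)) w by field; rewrite gt_eqF.
by rewrite ler_wpM2l// divr_ge0// ltW.
Qed.

(** Each drift enters once through telescoping and half a time through [regret_drift], hence the
    factor 3/2. *)
Lemma regret_bound (n : nat) : (n <= K)%N ->
  \sum_(k < n.+1) ip (g k) (x k.+1) + \sum_(k < n.+1)
     1 / (4 * eta) * wnorm2 ip (opsqrt ip (S k)) (x k.+1 - x k) <=
  eta * f 0 0 - eta * f n n.+1 +
    3 / 2 * eta * (optr (opsqrt ip (S n)) - optr (opsqrt ip (S 0%N))).
Proof.
elim: n => [_|n IHn nK].
  rewrite !big_ord1 subrr mulr0 addr0 -mulrBr.
  have := regret_step (leq0n K).
  (* The first step has no drift, because [M 0] is the empty sum and [x 0 = 0]. *)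
  have -> : y 0%N = 0 by rewrite /y /M big_ord0 linear0 scaler0 oppr0.
  by rewrite x_init subrr /wnorm2 ip0l mulr0 addr0.
rewrite big_ord_recr [X in _ + X <= _]big_ord_recr /=.
have := IHn (ltnW nK); have := regret_step nK; have := regret_drift nK.
have := optr_rootB_le (S_pd n) (S_pd n.+1) (S_mono n) (M n.+1).
rewrite -!/(f _ _).
set F0 := f 0%N 0%N; set F1 := f n n.+1; set F2 := f n.+1 n.+1;
  set F3 := f n.+1 n.+2.
set C0 := optr (opsqrt ip (S 0%N)); set C1 := optr (opsqrt ip (S n)).
set C2 := optr (opsqrt ip (S n.+1)).
set W := 1 / (2 * eta) * _; set Q := 1 / (4 * eta) * _.
set s1 := \sum_(_ < _) _; set s2 := \sum_(_ < _) _; set G := ip _ _.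
move=> FC; have : eta * (F2 - F1) <= eta * (C2 - C1) by rewrite ler_wpM2l// ltW.
lra.
Qed.

(** The regret is affine in [u], so the dual norm gives its maximum; as [eta = r], the value is
    absorbed by the final term [- eta * f K K.+1]. *)
Lemma regret_maximum r : 0 <= r -> eta = r ->
  exists2 Reg : R,
    is_maximum [set \sum_(k < K.+1) ip (g k) (x k.+1 - u)
                 | u in rho_ball ip H r] Reg
    & Reg <= eta * f 0 0 + 3 / 2 * eta * optr (opsqrt ip (S K)) -
        \sum_(k < K.+1)
          1 / (4 * eta) * wnorm2 ip (opsqrt ip (S k)) (x k.+1 - x k).
Proof.
move=> r0 er; have [ub [v rv vE]] := dual_normP (- M K.+1) r0.
have regE u : \sum_(k < K.+1) ip (g k) (x k.+1 - u) =
    \sum_(k < K.+1) ip (g k) (x k.+1) + ip (- M K.+1) u.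
  rewrite ipNl /M ip_suml -sumrN -big_split; apply: eq_bigr => k _ /=.
  by rewrite ipDr ipNr.
exists (\sum_(k < K.+1) ip (g k) (x k.+1 - v)).
  split; first by exists v.
  by move=> _ [u ru <-]; rewrite !regE lerD2l vE ub.
rewrite regE vE -er.
have := regret_bound (leqnn K); set s2 := \sum_(k < K.+1) 1 / _ * _.
(* The sign is harmless because [out] is even. *)
have PS : loewner_le ip (P (- M K.+1)) (P (M K.+1) + S K).
  rewrite /loewner_le /P outN addrAC subrr add0r.
  exact: pd_psd.
have := opsqrt_le (psd_P _) (pd_psd (pd_reg (S_pd K) _)) PS.
rewrite -regrootE => /optr_ge0; rewrite optrB -/(f _ _) subr_ge0 => le1.
have c0 := optr_ge0 (pd_psd (pd_opsqrt (S_pd 0%N))).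
have : eta * optr (opsqrt ip (P (- M K.+1))) <= eta * f K K.+1.
  by rewrite ler_wpM2l// ltW.
have : 0 <= 3 / 2 * eta * optr (opsqrt ip (S 0%N)).
  by rewrite mulr_ge0// mulr_ge0 ?(ltW eta0)// divr_ge0.
lra.
Qed.

End Regret.

End Regularizer.

Theorem theorem2 (R : realType) (X : vectType R) (ip : {dot X for idfun})
    (H : {vspace 'End(X)})
    (H_selfadjoint : forall A, A \in H -> selfadjoint ip A)
    (H_id : (\1%VF : 'End(X)) \in H)
    (H_quad : forall A B, A \in H -> B \in H -> (A \o B \o A)%VF \in H)
    (H_proj : forall A, pd ip A -> pd ip (oproj ip H A))
    (r eta : R) (r_gt0 : 0 < r) (eta_def : eta = r)
    (S : nat -> 'End(X))
    (S_in : forall k, S k \in H)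
    (S_pd : forall k, pd ip (S k))
    (S_mono : forall k, loewner_le ip (S k) (S k.+1))
    (K : nat) (g x : nat -> X)
    (x_init : x 0%N = 0)
    (x_step : forall k : nat, (k <= K)%N ->
       x k.+1 = - grad ip (Psi_star ip H eta (S k)) (\sum_(i < k.+1) g i)) :
  exists2 Reg : R,
    is_maximum [set \sum_(k < K.+1) ip (g k) (x k.+1 - u)
                 | u in rho_ball ip H r] Reg
    & Reg <= Psi_star ip H eta (S 0%N) 0
             + 3 / 2 * eta * trnorm ip (opsqrt ip (S K))
             - \sum_(k < K.+1)
                 1 / (4 * eta) * wnorm2 ip (opsqrt ip (S k)) (x k.+1 - x k).
Proof.
have eta0 : 0 < eta by rewrite eta_def.
have step k : (k <= K)%N -> x k.+1 =
    - (eta *: invregroot (ip := ip) H (S k) (\sum_(i < k.+1) g i)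
                (\sum_(i < k.+1) g i)).
  by move=> kK; rewrite x_step// grad_Psi_star.
have [Reg maxReg RegP] := regret_maximum H_selfadjoint H_id H_quad H_proj eta0
  S_in S_pd S_mono x_init step (ltW r_gt0) eta_def.
exists Reg => //; rewrite Psi_starE// trnormE; last exact/pd_psd/pd_opsqrt.
(* The initial dual point is an empty sum, matching the argument 0 of [Psi_star]. *)
by rewrite big_ord0 in RegP.
Qed.
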